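(* Let $(x_n)_{n\in\mathbb{N}}$ be a sequence in $[0,1)$. Suppose there exist $Z\in\mathbb{N}$, some $\gamma>0$, and infinitely many $N\in\mathbb{N}$ such that the set $\{x_1,\ldots,x_N\}$ has at most $Z$ distinct distances between neighboring elements (gap lengths). Then $(x_n)_{n\in\mathbb{N}}$ does not have $(k,1)$-Poissonian box correlations for any integer $k\geq 2$.
   Context: $\Vert x\Vert=\min_{z\in\mathbb{Z}}|x-z|$. For points $x_1,\ldots,x_N\in[0,1)$ ordered as $y_1\le y_2\le\cdots\le y_N$, the gaps (distances between neighboring elements) are $\Vert y_{i+1}-y_i\Vert$ for $1\le i<N$ together with $\Vert y_1-y_N\Vert$. For $k\ge2$ and $s_1,\ldots,s_{k-1}>0$ define \[ R_{k,1}(s_1,\ldots,s_{k-1},N)=\frac{\#\{(i_1,\ldots,i_k): 1\le i_1,\ldots,i_k\le N\text{ distinct},\ \Vert x_{i_l}-x_{i_k}\Vert\le s_l/N \text{ for } l=1,\ldots,k-1\}}{N}. \] The sequence has $(k,1)$-Poissonian box correlations if $\lim_{N\to\infty}R_{k,1}(s_1,\ldots,s_{k-1},N)=\prod_{l=1}^{k-1}2s_l$ for all $s_1,\ldots,s_{k-1}>0$. *)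

(* Defs.v *)
(* MathComp-Analysis; the reals are an arbitrary R : realType. *)
From mathcomp Require Import all_boot all_order all_algebra.
From mathcomp Require Import all_classical all_reals all_analysis.
Set Implicit Arguments.
Unset Strict Implicit.
Unset Printing Implicit Defensive.
Import Order.TTheory GRing.Theory Num.Theory.
Import numFieldNormedType.Exports.
Local Open Scope classical_set_scope.
Local Open Scope ring_scope.

(* Sequences are indexed from 0: x n stands for the point x_{n+1}, so that
   x_1, ..., x_N are the values x i for i < N. *)

(* The infimum is a minimum, see int_distP. *)
Definition int_dist (R : realType) (x : R) : R :=
  inf (range (fun z : int => `|x - z%:~R|)).

Definition sorted_points (R : realType) (x : nat -> R) (N : nat) : seq R :=
  sort <=%R (mkseq x N).

(* The last entry is the gap going around the circle R/Z. Repeated points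
   contribute gaps of length 0. *)
Definition gaps (R : realType) (x : nat -> R) (N : nat) : seq R :=
  let y := sorted_points x N in
  rcons (mkseq (fun i => int_dist (y`_i.+1 - y`_i)) N.-1)
        (int_dist (y`_0 - y`_N.-1)).

Definition num_gap_lengths (R : realType) (x : nat -> R) (N : nat) : nat :=
  size (undup (gaps x N)).

(* For k >= 1, 'I_k.-1.+1 is the index set of the tuple (i_1, ..., i_k):
   ord_max is the index of i_k and lift ord_max l, which has the same value
   as l : 'I_k.-1, that of one of the k - 1 other entries. *)
Definition box_corr (R : realType) (k : nat) (x : nat -> R)
    (s : 'I_k.-1 -> R) (N : nat) : R :=
  #|[pred i : {ffun 'I_k.-1.+1 -> 'I_N} | injectiveb i &&
      [forall l : 'I_k.-1,
         int_dist (x (i (lift ord_max l)) - x (i ord_max)) <= s l / N%:R]]|%:R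
  / N%:R.

Definition poissonian_box_corr (R : realType) (k : nat) (x : nat -> R) : Prop :=
  forall s : 'I_k.-1 -> R, (forall l, 0 < s l) ->
    box_corr x s N @[N --> \oo] --> \prod_(l < k.-1) (2 * s l).

Lemma int_distP (R : realType) (x : R) :
  (exists z : int, int_dist x = `|x - z%:~R|) /\
  (forall z : int, int_dist x <= `|x - z%:~R|).
Proof.
have lbE : has_lbound (range (fun z : int => `|x - z%:~R|)).
  by exists 0 => _ [z _ <-].
have le z : int_dist x <= `|x - z%:~R| by apply: ge_inf => //; exists z.
split=> //.
suff [z zP] : exists z : int, forall t : int, `|x - z%:~R| <= `|x - t%:~R|.
  exists z; apply/eqP; rewrite eq_le le /=; apply: lb_le_inf.
    by exists `|x - 0%:~R|; exists 0.
  by move=> _ [t _ <-].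
have f1 : (Num.floor x)%:~R <= x by rewrite floor_le.
have f2 : x < (Num.floor x)%:~R + 1 by have := floorD1_gt x; rewrite intrD.
have far (t : int) : x - (Num.floor x)%:~R <= `|x - t%:~R| \/
               (Num.floor x)%:~R + 1 - x <= `|x - t%:~R|.
  have [tf|ft] := leP t (Num.floor x); [left|right].
    apply: le_trans (ler_norm _); rewrite lerB //.
    by rewrite ler_int.
  rewrite distrC; apply: le_trans (ler_norm _); rewrite lerB //.
  by rewrite -(intrD _ _ 1) ler_int lezD1.
have e1 : `|x - (Num.floor x)%:~R| = x - (Num.floor x)%:~R.
  by rewrite ger0_norm // subr_ge0.
have e2 : `|x - (Num.floor x + 1)%:~R| = (Num.floor x)%:~R + 1 - x.
  by rewrite intrD distrC ger0_norm // subr_ge0 ltW.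
have [h|h] := leP (x - (Num.floor x)%:~R) ((Num.floor x)%:~R + 1 - x).
  exists (Num.floor x) => t; rewrite e1; case: (far t) => //.
  exact: le_trans.
exists (Num.floor x + 1) => t; rewrite e2; case: (far t) => //.
by apply: le_trans; apply: ltW.
Qed.

(* Main.v *)
(* At a bad N some gap length d is shared by at least N/Z points, and d <= Z/N
   since the gaps sum to at most 1. With w = 4 Z (k - 1), at most half of these
   points have fewer than k points within w/N: cutting the circle into cells
   shorter than w/N, each cell holds at most k - 1 such isolated points. So
   s |-> R_{k,1}(s, w, ..., w, N) jumps by at least 1/(2Z) at s = N d, which
   lies in [0, Z]. As N grows along the bad values, this is incompatible with
   convergence to the linear function s |-> 2 s (2 w)^(k-2) at the points of a
   fine enough grid of (0, Z]. *)
Require Import Defs.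
From mathcomp Require Import all_boot all_order all_algebra.
From mathcomp Require Import all_classical all_reals all_analysis.
From mathcomp Require Import zify lra.
Set Implicit Arguments.
Unset Strict Implicit.
Unset Printing Implicit Defensive.
Import Order.TTheory GRing.Theory Num.Theory.
Import numFieldNormedType.Exports.
Local Open Scope ring_scope.

(** * Finite counting: fibers and injective tuples *)

Lemma card_le_fibers (T U : finType) (f : T -> U) (P : {set T}) (m : nat) :
  (forall p, p \in P -> #|[set j | f j == f p]| <= m)%N ->
  (#|P| <= #|U| * m)%N.
Proof.
move=> fm; rewrite -sum1_card (partition_big f xpredT) //= -sum_nat_const.
apply: leq_sum => u _; rewrite sum1dep_card.
have [p|P0] := pickP [pred p in P | f p == u]; last first.
  by rewrite eq_card0 // => p; rewrite inE; apply: P0.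
case/andP=> pP /eqP <-; apply: leq_trans (fm p pP); apply: subset_leq_card.
by apply/fintype.subsetP => j; rewrite !inE => /andP[].
Qed.

(** Pigeonhole, meant for the map from a point to the gap that follows it. A fiber of maximal size
    works, since the at most [Z] fibers cover [T]; [t0] rules out an empty [T]. *)
Lemma ex_large_fiber (T : finType) (U : eqType) (f : T -> U) (t0 : T) (Z : nat) :
  (size (undup (codom f)) <= Z)%N ->
  exists t, (#|T| <= Z * #|[set i | f i == f t]|)%N.
Proof.
move=> fZ; pose F t := #|[set i | f i == f t]|.
case: (@arg_maxnP _ t0 xpredT F isT) => t _ tmax; exists t; rewrite -/(F t).
apply: (@leq_trans (size (undup (codom f)) * F t)%N); last first.
  by rewrite leq_mul2r fZ orbT.
have <- : (\sum_(d <- undup (codom f)) \sum_(i | f i == d) 1 = #|T|)%N.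
  rewrite (exchange_big_dep xpredT) //= -sum1_card; apply: eq_bigr => i _.
  rewrite sum1_count (eq_count (a2 := pred1 (f i))) ?count_uniq_mem ?undup_uniq//.
  by rewrite mem_undup codom_f.
rewrite -sum1_size big_distrl /= 2!big_seq; apply: leq_sum => d.
rewrite mem_undup => /codomP[i ->]; rewrite mul1n.
by rewrite sum1dep_card; apply: tmax.
Qed.

(** Builds the tuples counted by [box_corr]: [p] is the centre, [q] its successor. [B] may contain
    both, so two of its elements can be lost, and [m] remain for the other entries. *)
Lemma ex_inj_tuple (T : finType) (m : nat) (p q : T) (B : {set T}) :
  q != p -> (m.+2 <= #|B|)%N ->
  exists i : {ffun 'I_m.+2 -> T}, [/\ injective i, i ord_max = p,
    i (lift ord_max ord0) = q & forall l, l != ord0 -> i (lift ord_max l) \in B].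
Proof.
move=> qp mB; pose e := take m (enum (B :\ p :\ q)).
have sub j : j \in e -> [&& j != q, j != p & j \in B].
  by move=> /mem_take; rewrite mem_enum !inE.
have se : size e = m.
  rewrite size_take -cardE; case: ltnP => // le.
  apply/eqP; rewrite eqn_leq le /=.
  by move: mB; rewrite (cardsD1 p) (cardsD1 q (B :\ p)); lia.
have ue : uniq (q :: rcons e p).
  rewrite /= mem_rcons inE negb_or qp /= rcons_uniq.
  rewrite take_uniq ?enum_uniq// andbT; apply/andP; split.
    by apply/negP => /sub /and3P[/eqP].
  by apply/negP => /sub /and3P[_ /eqP].
have sz : size (q :: rcons e p) = m.+2 by rewrite /= size_rcons se.
exists [ffun j : 'I_m.+2 => nth p (q :: rcons e p) j]; split.
- move=> a b; rewrite !ffunE => /eqP; rewrite nth_uniq ?sz//.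
  by move=> /eqP /val_inj.
- by rewrite ffunE /= nth_rcons se ltnn eqxx.
- by rewrite ffunE lift_max.
- case=> -[//|l] lm _; rewrite ffunE lift_max /= nth_rcons se -ltnS lm.
  have : nth p e l \in e by rewrite mem_nth ?se // -ltnS.
  by move=> /sub /and3P[].
Qed.

(** * Gaps around the circle *)

Lemma int_dist_ge0 (R : realType) (u : R) : 0 <= int_dist u.
Proof. by have [[z ->] _] := int_distP u. Qed.

Lemma int_dist_le_norm (R : realType) (u : R) : int_dist u <= `|u|.
Proof. by have [_ /(_ 0)] := int_distP u; rewrite subr0. Qed.

Lemma int_dist_le_normD1 (R : realType) (u : R) : int_dist u <= `|u + 1|.
Proof. by have [_ /(_ (-1))] := int_distP u; rewrite opprK. Qed.

(** The inner gaps telescope to at most [y_n - y_0]. The gap around the circle, measured against the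
    integer [-1], is at most [y_0 - y_n + 1]. *)
Lemma sum_gaps_le1 (R : realType) (x : nat -> R) (n : nat) :
  (forall i, 0 <= x i < 1) -> \sum_(d <- gaps x n.+1) d <= 1.
Proof.
move=> hx; rewrite /gaps big_rcons /=; set y := sorted_points x n.+1.
have sy : size y = n.+1 by rewrite size_sort size_mkseq.
have y01 i : (i < n.+1)%N -> 0 <= y`_i < 1.
  move=> iN; have : y`_i \in y by rewrite mem_nth ?sy.
  by rewrite mem_sort => /mapP[j _ ->].
have ymon i j : (i <= j)%N -> (j < n.+1)%N -> y`_i <= y`_j.
  move=> ij jn; have := sort_le_sorted (mkseq x n.+1).
  move=> /(sorted_leq_nth le_trans le_refl 0); apply=> //.
    by rewrite inE sy (leq_ltn_trans ij).
  by rewrite inE sy.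
rewrite big_map -{1}(subn0 n) -/(index_iota 0 n).
have h : \sum_(0 <= i < n) int_dist (y`_i.+1 - y`_i) <= y`_n - y`_0.
  rewrite -telescope_sumr // !big_nat; apply: ler_sum => i /andP[_ ilt].
  by apply: le_trans (int_dist_le_norm _) _; rewrite ger0_norm // subr_ge0 ymon.
have h1 : int_dist (y`_0 - y`_n) <= y`_0 - y`_n + 1.
  apply: le_trans (int_dist_le_normD1 _) _; rewrite ger0_norm //.
  by have /andP[? _] := y01 0 isT; have /andP[_ ?] := y01 n (ltnSn n); lra.
by apply: le_trans (lerD h h1) _; lra.
Qed.

(** [q] goes to the next index in the cyclic order of the points. Indices are sorted instead of
    values, so that repeated points stay apart. Multiplicities are kept, so both the sum and the
    number of gap lengths carry over. *)
Lemma gap_successor (R : realType) (x : nat -> R) (n : nat) :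
  exists q : 'I_n.+1 -> 'I_n.+1, ((0 < n)%N -> forall p, q p != p) /\
    perm_eq (gaps x n.+1) (codom (fun p => int_dist (x (q p) - x p))).
Proof.
pose t := sort (relpre x <=%R) (iota 0 n.+1).
have pt : perm_eq t (iota 0 n.+1) by rewrite perm_sort.
have st : size t = n.+1 by rewrite (perm_size pt) size_iota.
have tlt i : (i < n.+1)%N -> (nth 0 t i < n.+1)%N.
  move=> iN; have : nth 0%N t i \in t by rewrite mem_nth ?st.
  by rewrite (perm_mem pt) mem_iota.
pose sg (i : 'I_n.+1) := Ordinal (tlt i (ltn_ord i)).
have sgI : injective sg.
  move=> i j /(congr1 val) /= /eqP; rewrite nth_uniq ?st//.
    by move=> /eqP /val_inj.
  by rewrite (perm_uniq pt) iota_uniq.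
have yE i : (i < n.+1)%N -> (sorted_points x n.+1)`_i = x (nth 0%N t i).
  by move=> iN; rewrite /sorted_points sort_map (nth_map 0%N) ?st.
pose rs := invF sgI.
exists (fun p => sg (ordS (rs p))); split=> [n0 p|].
  rewrite -[X in _ != X](f_invF sgI p) (inj_eq sgI) -/(rs p).
  case: (rs p) => i ilt; apply/eqP => /(congr1 val) /=.
  have := ilt; rewrite leq_eqVlt => /orP[/eqP e|lt].
    by rewrite e modnn; lia.
  by rewrite modn_small //; lia.
have -> : gaps x n.+1 = [seq int_dist (x (sg (ordS (rs p))) - x p) |
                          p <- [seq sg i | i <- enum 'I_n.+1]].
  rewrite -map_comp; apply: (@eq_from_nth _ 0).
    by rewrite size_rcons size_mkseq size_map size_enum_ord.
  move=> i; rewrite size_rcons size_mkseq /= => iN.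
  rewrite nth_rcons size_mkseq (nth_map ord0) ?size_enum_ord //=.
  rewrite /rs invF_f nth_enum_ord //; case: ltnP => ilt.
    by rewrite nth_mkseq //= !yE // modn_small.
  (* At the last position [ordS] wraps around to the smallest point. *)
  have -> : i = n by lia.
  by rewrite eqxx modnn !yE.
apply: perm_map; apply: uniq_perm.
- by rewrite map_inj_uniq ?enum_uniq.
- exact: enum_uniq.
- move=> p; rewrite mem_enum -[p](f_invF sgI) mem_map ?mem_enum //.
Qed.

(** * Isolated points *)

Definition near_points (R : realType) (x : nat -> R) (N : nat) (r : R) (p : 'I_N) :
  {set 'I_N} := [set j : 'I_N | int_dist (x j - x p) <= r].

Lemma card_isolated_points (R : realType) (x : nat -> R) (n s m : nat) :
  (forall i, 0 <= x i < 1) -> (0 < s)%N ->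
  (#|[set p : 'I_n.+1 | #|near_points x (s%:R / n.+1%:R) p| <= m]|
     <= (n.+1 %/ s).+1 * m)%N.
Proof.
move=> hx s0; set M := (n.+1 %/ s)%N.
(* The index of the cell of [x i], among [M.+1] cells of length [1 / M.+1]. As [x i < 1], the
   default value of [inord] is never taken. *)
pose c (i : 'I_n.+1) : 'I_M.+1 := inord (Num.truncn (x i * M.+1%:R)).
have cE i : c i = Num.truncn (x i * M.+1%:R) :> nat.
  have /andP[x0 x1] := hx i.
  rewrite inordK // truncn_lt_nat ?mulr_ge0 //.
  by rewrite -[ltRHS]mul1r ltr_pM2r.
rewrite -[M.+1]card_ord; apply: (@card_le_fibers _ _ c) => p.
(* It suffices that the whole cell of [p] lies in its [near_points]. *)
rewrite inE; apply: leq_trans; apply: subset_leq_card.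
apply/fintype.subsetP => j; rewrite !inE => /eqP cjp.
have := congr1 val cjp; rewrite /= !cE => e.
have /andP[xj0 _] := hx j; have /andP[xp0 _] := hx p.
have /truncn_itv /andP[j1 j2] : 0 <= x j * M.+1%:R by rewrite mulr_ge0.
have /truncn_itv /andP[p1 p2] : 0 <= x p * M.+1%:R by rewrite mulr_ge0.
apply: le_trans (int_dist_le_norm _) _.
(* The choice of [M]: a cell is no longer than [s / n.+1]. *)
have MS : n.+1%:R <= s%:R * M.+1%:R :> R.
  by rewrite -natrM ler_nat mulnC ltnW // ltn_ceil.
rewrite ler_pdivlMr // -(ler_pM2r (_ : 0 < M.+1%:R)) //.
have d1 : `|x j - x p| * M.+1%:R <= 1.
  rewrite -[X in _ * X]normr_nat -normrM mulrBl.
  move: j1 j2 p1 p2; rewrite e -natr1 => *; rewrite ler_norml; lra.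
rewrite mulrAC; apply: le_trans (ler_pM _ _ d1 MS) _; rewrite ?mulr_ge0 //.
by rewrite mul1r.
Qed.

(** * The jump of the box correlations at a gap length *)

Definition box_sides (R : realType) (m : nat) (u w : R) (l : 'I_m.+1) : R :=
  if l == ord0 then u else w.

(* Each [t] in [L] contributes a tuple [i] with [x (i_1)] at distance exactly
   [d] from [x (i_k)], which is counted for the side [v] but not for [u]. *)
Lemma box_corr_jump (R : realType) (x : nat -> R) (m n : nat) (d u v w : R)
    (q : 'I_n.+1 -> 'I_n.+1) (L : {set 'I_n.+1}) :
  u / n.+1%:R < d <= v / n.+1%:R ->
  (forall p, p \in L -> [/\ q p != p, int_dist (x (q p) - x p) = d &
     (m.+2 <= #|near_points x (w / n.+1%:R) p|)%N]) ->
  #|L|%:R / n.+1%:R + @box_corr R m.+2 x (box_sides u w) n.+1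
    <= @box_corr R m.+2 x (box_sides v w) n.+1.
Proof.
move=> /andP[ud dv] hL.
rewrite -mulrDl ler_pM2r ?invr_gt0 // -natrD ler_nat /=.
set A := fun s => [pred i : {ffun 'I_m.+2 -> 'I_n.+1} | injectiveb i &&
  [forall l, int_dist (x (i (lift ord_max l)) - x (i ord_max)) <=
     box_sides s w l / n.+1%:R]].
pose E := [set i in A v | int_dist (x (i (lift ord_max ord0)) - x (i ord_max)) == d].
have LE : (#|L| <= #|E|)%N.
  (* Distinct [p] give distinct tuples, since [p] is recovered as the last entry. *)
  apply: (@leq_trans #|[set (i : {ffun _ -> _}) ord_max | i in E]|); last first.
    exact: leq_imset_card.
  apply: subset_leq_card; apply/fintype.subsetP => p pL.
  have [qp qd mB] := hL p pL.
  have [i [inji ip iq iB]] := ex_inj_tuple qp mB.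
  apply/imsetP; exists i => //; rewrite !inE ip iq qd eqxx andbT.
  apply/andP; split; first exact/injectiveP.
  apply/forallP => l; rewrite /box_sides; case: eqVneq => [->|l0].
    by rewrite iq qd.
  by have := iB l l0; rewrite inE.
apply: (@leq_trans (#|E| + #|[set i in A u]|)%N).
  by rewrite leq_add // cardsE.
have dis : E :&: [set i in A u] = finset.set0.
  apply/eqP; rewrite -finset.subset0; apply/fintype.subsetP => i; rewrite !inE.
  move=> /andP[/andP[_ /eqP e]] /andP[_ /forallP /(_ ord0)].
  by rewrite e /box_sides eqxx leNgt ud.
have := cardsUI E [set i in A u]; rewrite dis cards0 addn0 => <-.
apply: subset_leq_card; apply/fintype.subsetP => i.
rewrite !inE => /orP[/andP[]|] // /andP[-> /forallP h].
apply/forallP => l; apply: le_trans (h l) _; rewrite ler_pM2r ?invr_gt0 //.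
rewrite /box_sides; case: ifP => // _.
by rewrite -(ler_pM2r (_ : 0 < n.+1%:R^-1)) ?invr_gt0 // ltW // (lt_le_trans ud).
Qed.

(** * Frequent gaps at bad values of [N], and the contradiction *)

Lemma infinite_nat_unbounded (A : set nat) (n : nat) :
  infinite_set A -> exists N, A N /\ (n <= N)%N.
Proof.
move=> Ainf; apply: contrapT => h; apply: Ainf.
apply: (sub_finite_set _ (finite_II n)) => N AN.
by rewrite /= ltnNge; apply/negP => nN; apply: h; exists N.
Qed.

Lemma frequent_gap (R : realType) (x : nat -> R) (Z m n : nat) :
  (forall i, 0 <= x i < 1) -> (0 < Z)%N -> (4 * Z * m.+1 <= n.+1)%N ->
  (num_gap_lengths x n.+1 <= Z)%N ->
  exists (d : R) (q : 'I_n.+1 -> 'I_n.+1) (L : {set 'I_n.+1}),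
    [/\ 0 <= d <= Z%:R / n.+1%:R, (n.+1 <= 2 * Z * #|L|)%N &
      forall p, p \in L -> [/\ q p != p, int_dist (x (q p) - x p) = d &
        (m.+2 <= #|near_points x ((4 * Z * m.+1)%:R / n.+1%:R) p|)%N]].
Proof.
move=> hx Z0 nbig hZ; have [q [qne qperm]] := gap_successor x n.
set g := fun p => int_dist (x (q p) - x p) in qperm.
have gsum : \sum_p g p <= 1.
  have := sum_gaps_le1 n hx.
  by rewrite (perm_big _ qperm) /= big_image.
have [t tZ] : exists t, (#|'I_n.+1| <= Z * #|[set i | g i == g t]|)%N.
  apply: (ex_large_fiber ord0).
  by rewrite -(perm_size (perm_undup (perm_mem qperm))).
rewrite card_ord in tZ; set P := [set i | g i == g t] in tZ.
set s := (4 * Z * m.+1)%N.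
pose I := [set p : 'I_n.+1 | (#|near_points x (s%:R / n.+1%:R) p| <= m.+1)%N].
have s0 : (0 < s)%N by rewrite !muln_gt0 Z0.
have Ile := card_isolated_points n m.+1 hx s0.
exists (g t), q, (P :\: I); split.
(* The gaps in [P] alone sum to [#|P| * g t <= 1], while [n.+1 <= Z * #|P|]. *)
- rewrite int_dist_ge0 /= ler_pdivlMr //.
  have : #|P|%:R * g t <= 1.
    apply: le_trans gsum; rewrite (bigID (mem P)) /= -[leLHS]addr0 lerD //.
      rewrite mulr_natl -sumr_const; apply: ler_sum => i.
      by rewrite inE => /eqP ->.
    by apply: sumr_ge0 => i _; apply: int_dist_ge0.
  move=> h; apply: (@le_trans _ _ (g t * (Z * #|P|)%:R)).
    by rewrite ler_wpM2l ?int_dist_ge0 // ler_nat.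
  by rewrite natrM mulrCA ger_pMr ?ltr0n // mulrC.
(* The factor 4 in [s]: the cell bound gives [4 Z #|I| <= n.+1 + s <= 2 n.+1], so discarding [I]
   costs at most half of [n.+1 <= Z #|P|]. *)
- have IN : (4 * Z * #|I| <= 2 * n.+1)%N.
    apply: leq_trans (leq_mul (leqnn (4 * Z)) Ile) _.
    by rewrite mulnCA mulSn mul2n -addnn leq_add // leq_trunc_div.
  have : (Z * #|P| <= Z * #|I| + Z * #|P :\: I|)%N.
    rewrite -mulnDr leq_mul2l -(cardsID I P) leq_add2r.
    by rewrite subset_leq_card ?orbT //; apply: subsetIr.
  move: IN tZ; rewrite -!mulnA; move: (Z * _)%N (Z * _)%N (Z * _)%N => a b c.
  by lia.
- move=> p; rewrite !inE => /andP[]; rewrite -ltnNge => ? /eqP gp; split=> //.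
  (* Since [n.+1 >= s >= 4], there is more than one point. *)
  apply: qne; move: nbig s0; rewrite -/s /s; nia.
Qed.

Local Open Scope classical_set_scope.

Theorem theorem1p6 (R : realType) (x : nat -> R)
    (hx : forall n : nat, 0 <= x n < 1)
    (hgaps : exists (Z : nat) (gamma : R), 0 < gamma /\
       infinite_set [set N : nat | (num_gap_lengths x N <= Z)%N]) :
  forall k : nat, (2 <= k)%N -> ~ poissonian_box_corr k x.
Proof.
case: hgaps => Z0 [_ [_ Zinf]] [//|[//|m]] _ hk.
(* [Z] is made positive. The slope of the limit is [c], and the jump [1 / (2 Z)] equals [8 eta]. It
   will be compared with [3 eta]: one [eta] for the growth of the limit over a grid step [eps], and
   one for the error at each end. *)
pose Z := Z0.+1; pose w : R := (4 * Z * m.+1)%:R.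
pose c : R := 2 * (2 * w) ^+ m; pose eta : R := (16 * Z)%:R^-1.
have w0 : 0 < w by rewrite ltr0n.
have c0 : 0 < c by rewrite mulr_gt0 // exprn_gt0 // mulr_gt0.
have eta0 : 0 < eta by rewrite invr_gt0 ltr0n.
pose eps := eta / c.
have eps0 : 0 < eps by rewrite divr_gt0.
pose F (u : R) := @box_corr R m.+2 x (box_sides u w).
have Fcvg u : 0 < u -> F u N @[N --> \oo] --> c * u.
  move=> u0; have /hk : forall l, 0 < @box_sides R m u w l.
    by move=> l; rewrite /box_sides; case: ifP.
  suff -> : \prod_(l < m.+1) (2 * box_sides u w l) = c * u by [].
  rewrite big_ord_recl /box_sides eqxx (eq_bigr (fun=> 2 * w)) //.
  by rewrite prodr_const card_ord mulrAC.
pose T := (Num.truncn (Z%:R / eps)).+1.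
have ZT : Z%:R <= T%:R * eps.
  by rewrite -ler_pdivrMr // ltW // truncnS_gt.
(* The grid up to [Z] is finite, so one [N0] serves all its points. *)
have [N0 _ FN0] : \forall N \near \oo, forall j : 'I_T,
    `|c * (j.+1%:R * eps) - F (j.+1%:R * eps) N| < eta.
  apply: filter_forall => j.
  by apply: (cvgr_dist_lt _ _ (Fcvg _ _)); rewrite // mulr_gt0.
have [[|n] [/= hN nlarge]] := infinite_nat_unbounded (N0 + 4 * Z * m.+1) Zinf.
  by move: nlarge; lia.
have [d [q [L [/andP[d0 dZ] LZ hL]]]] :
    exists (d : R) (q : 'I_n.+1 -> 'I_n.+1) (L : {set 'I_n.+1}), _ :=
  frequent_gap hx (ltn0Sn Z0) (leq_trans (leq_addl _ _) nlarge) (leqW hN).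
have FN (j : nat) : (j < T)%N -> `|c * (j.+1%:R * eps) - F (j.+1%:R * eps) n.+1| < eta.
  by move=> jT; apply: (FN0 n.+1 _ (Ordinal jT)); rewrite /=; lia.
have Lbig : 8 * eta <= #|L|%:R / n.+1%:R.
  rewrite ler_pdivlMr // /eta mulrAC ler_pdivrMr ?ltr0n //.
  rewrite -!natrM ler_nat; move: LZ; rewrite -/Z; lia.
have ceps : c * eps = eta by rewrite mulrC divfK // gt_eqF.
have ex : exists j, d * n.+1%:R <= j.+1%:R * eps.
  exists T; rewrite -ler_pdivlMr // (le_trans dZ) // ler_pM2r ?invr_gt0 //.
  by rewrite (le_trans ZT) // ler_pM2r // ler_nat.
(* The first grid point at or above [d * n.+1]: the jump occurs between it and its predecessor. *)
case: (ex_minnP ex) => j dj jmin.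
have jT : (j < T)%N.
  rewrite ltnS; apply: jmin; rewrite -ler_pdivlMr // (le_trans dZ) //.
  by rewrite ler_pM2r ?invr_gt0.
(* Repeated points may give [d = 0], so the predecessor of the first grid point has to be negative.
   Convergence says nothing there, but [0 <= F u] is enough. *)
pose u : R := if j is j'.+1 then j'.+1%:R * eps else -1.
have ud : u / n.+1%:R < d <= j.+1%:R * eps / n.+1%:R.
  rewrite ler_pdivlMr // dj andbT ltr_pdivrMr //.
  rewrite /u; case: (j) jmin => [|j'] jmin.
    by rewrite (lt_le_trans (_ : _ < 0)) // mulr_ge0.
  by rewrite ltNge; apply/negP => /jmin; rewrite ltnn.
have := box_corr_jump ud hL; rewrite -!/(F _ _).
have Fu : c * (j%:R * eps) - eta <= F u n.+1.
  rewrite /u; case: (j) jT => [_|j' jT].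
    rewrite mul0r mulr0 add0r; apply: (@le_trans _ _ 0).
      by rewrite oppr_le0 ltW.
    exact: divr_ge0.
  by have := FN _ (ltnW jT); rewrite ltr_norml => /andP[_]; lra.
have := FN _ jT; rewrite ltr_norml -natr1 mulrDl mul1r mulrDr ceps.
move=> /andP[lo _] /(le_trans (lerD Lbig Fu)); move: lo eta0.
by move: (F _ _) (c * _) => a b; clearbody eta; lra.
Qed.
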